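(* Let $n\in\mathbb N$, $n\ge 1$. For any $X_1,\dots,X_n\in\mathcal{B}_A(\mathcal{H})$, $$\Big\|\sum_{k=1}^{n} X_k\Big\|_A^2\leq \Big\|\sum_{k=1}^{n}X_k^{\sharp_A}X_k\Big\|_A+\frac{1}{2}\Big\|\sum_{\substack{1\leq k,j\leq n\\ j\neq k}}X_j^{\sharp_A}X_k\Big\|_A^2+\frac{1}{2}$$ $$= \Big\|\sum_{k=1}^{n}X_k^{\sharp_A}X_k\Big\|_A+\frac{1}{2}\Big\|\Big(\sum_{j=1}^{n}X_j^{\sharp_A}\Big)\Big(\sum_{k=1}^{n}X_k\Big)-\sum_{k=1}^{n}X_k^{\sharp_A}X_k\Big\|_A^2+\frac{1}{2}.$$
   Context: $(\mathcal{H},\langle\cdot,\cdot\rangle)$ is a complex Hilbert space, $\mathcal{B}(\mathcal{H})$ is the algebra of bounded linear operators on $\mathcal{H}$, and $A\in\mathcal{B}(\mathcal{H})$ is a fixed positive operator ($\langle Ax,x\rangle\ge 0$ for all $x$). Put $\langle x,y\rangle_A=\langle Ax,y\rangle$ and $\|x\|_A=\sqrt{\langle x,x\rangle_A}$ (a seminorm). $\mathcal{B}_A(\mathcal{H})=\{T\in\mathcal{B}(\mathcal{H}): \mathrm{ran}(T^*A)\subseteq \mathrm{ran}(A)\}$, equivalently the set of $T$ for which some $S\in\mathcal{B}(\mathcal{H})$ satisfies $AS=T^*A$. For $T\in\mathcal{B}_A(\mathcal{H})$, $T^{\sharp_A}$ is the reduced solution of $AX=T^*A$, i.e. the unique $X\in\mathcal{B}(\mathcal{H})$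 with $AX=T^*A$ and $\mathrm{ran}(X)\subseteq\overline{\mathrm{ran}(A)}$ (equivalently $T^{\sharp_A}=A^{\dagger}T^*A$, with $A^\dagger$ the Moore–Penrose inverse). The $A$-operator seminorm is $\|T\|_A=\sup\{\|Tx\|_A: x\in\mathcal{H},\ \|x\|_A=1\}$. *)

(* Defs.v *)
From HB Require Import structures.
From mathcomp Require Import all_boot all_order all_algebra.
From mathcomp Require Import all_classical all_reals all_analysis.
From mathcomp Require Import complex sesquilinear.

Set Implicit Arguments.
Unset Strict Implicit.
Unset Printing Implicit Defensive.

Import Order.TTheory GRing.Theory Num.Theory.
Import numFieldNormedType.Exports.

Local Open Scope classical_set_scope.
Local Open Scope ring_scope.

(* The norm of a normed module over R[i] takes its (real, nonnegative) values
   in R[i], so [hilbert_normE] is an equation in R[i]. A form of type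
   {dot H for Num.conj} is linear in its first argument. *)
Record hilbertSpace (R : realType) := HilbertSpace {
  hilbert_sort :> completeNormedModType R[i] ;
  inner : {dot hilbert_sort for Num.conj} ;
  hilbert_normE : forall x : hilbert_sort, `|x| ^+ 2 = inner x x }.

Section Operators.
Context {R : realType} {H : hilbertSpace R}.
Implicit Types (A S T : H -> H) (x y : H).

Definition bounded_operator : set (H -> H) :=
  [set T | linear T /\ exists M : R[i], forall x, `|T x| <= M * `|x|].

(* In R[i], 0 <= z means that z is real and nonnegative. *)
Definition positive_operator : set (H -> H) :=
  [set T | bounded_operator T /\ forall x, 0 <= inner H (T x) x].

(* A bounded operator has exactly one adjoint, so for bounded T the default
   value 0 is never used and the choice is forced. *)
Definition adjoint T : H -> H :=
  xget 0 [set S | bounded_operator S /\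
                  forall x y, inner H (T x) y = inner H x (S y)].

Definition bounded_A A : set (H -> H) :=
  [set T | bounded_operator T /\ range (adjoint T \o A) `<=` range A].

(* For T in bounded_A A there is exactly one reduced solution (Douglas). *)
Definition sharp A T : H -> H :=
  xget 0 [set S | [/\ bounded_operator S,
                      A \o S = adjoint T \o A &
                      range S `<=` closure (range A)]].

Definition innerA A x y : R[i] := inner H (A x) y.

(* Re only casts to R: innerA A x x is real when A is positive. *)
Definition normA A x : R := Num.sqrt (complex.Re (innerA A x x)).

(* The supremum is finite on bounded_A A; sup set0 = 0 covers A = 0. *)
Definition opnormA A T : R :=
  sup [set normA A (T x) | x in [set x | normA A x = 1]].

End Operators.

(* Main.v *)
Require Import Defs.
From mathcomp Require Import all_boot all_order all_algebra.
From mathcomp Require Import all_classical all_reals all_analysis.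
From mathcomp Require Import complex sesquilinear ring lra.

(** Write [p] for the seminorm of [A], [G] for the product of the sum of the
sharps with the sum of the [X k], [D] for its diagonal part and [E] for its
off-diagonal part, so that [G = D + E] because each sharp is additive. Moving
every [X j] across the form [<A x, y>] gives, when [p x = 1],
[p (\sum_k X k x) ^ 2 = <A (G x), x> = <A (D x), x> + <A (E x), x>],
and the Cauchy-Schwarz inequality for the form bounds the right-hand side by
[opnormA A D + opnormA A E]. Finally [t <= t ^ 2 / 2 + 1 / 2]. Three facts make
this rigorous.

The adjoint exists ([adjointP]). This is the Riesz representation theorem; it
is proved on an arbitrary subspace [M], with a representing vector in the
closure of [M] ([riesz_on_subspace]), so that it also provides orthogonal
projections on the closure of the range of [A].

The sharp exists and is bounded ([sharpP], a case of the factorisation theorem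
of Douglas). Its value at [x] is the projection on the closure of the range of
[A] of any preimage of [T^* A x]. Boundedness of this map [S] is an instance of
the uniform boundedness principle: by symmetry of [A],
[<S x, A w> = <x, A (T w)>], so the vectors [A (T w)] with [|A w| <= 1] form a
weakly bounded set, hence a bounded one ([weakly_bounded_bounded]), and the
vectors [A w] are dense where [S] takes its values.

The sets whose suprema are [opnormA A D] and [opnormA A E] are bounded above, so
that these numbers do bound the values in question
([adjoint_pair_normA_bounded]). An operator which is
symmetric for the form of [A] and bounded for the norm is bounded for [p]
([symmetric_normA_bounded]): the sequence of the [p] of its iterates at [x] is
log-convex, so a first ratio above the operator norm would force a growth
faster than the powers of that norm. This applies to the product of the sharp
of [T] with [T], and then gives bounds for [T] and for its sharp.

Everything is computed with the real part of the inner product: the complex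
identities that have to be recovered follow by replacing a vector by its
multiples. *)

Set Implicit Arguments.
Unset Strict Implicit.
Unset Printing Implicit Defensive.

Import Order.TTheory GRing.Theory Num.Theory.
Import numFieldNormedType.Exports.

Local Open Scope classical_set_scope.
Local Open Scope ring_scope.

(** * Real numbers *)

Lemma sqr_le_of_quadratic_ge0 (R : realType) (a b c : R) :
  0 <= a -> (forall t, 0 <= a * t ^+ 2 + 2 * b * t + c) -> b ^+ 2 <= a * c.
Proof.
move=> a0 h; have [e|/eqP ne] := eqVneq a 0.
  subst a; rewrite mul0r; have [->|/eqP bn] := eqVneq b 0; first by rewrite expr0n.
  exfalso; have := h (- (c + 1) / (2 * b)).
  rewrite mul0r add0r mulrC divfK; first by lra.
  by apply/eqP; lra.
have ap : 0 < a by lra.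
have := h (- b / a).
have -> : a * (- b / a) ^+ 2 + 2 * b * (- b / a) + c = c - b ^+ 2 / a.
  by field; apply/eqP.
by rewrite subr_ge0 ler_pdivrMr // mulrC.
Qed.

Lemma expr_unbounded (R : realType) (q K : R) : 1 < q -> exists m, K < q ^+ m.
Proof.
move=> q1; pose d := q - 1; have d0 : 0 < d by rewrite subr_gt0.
have bernoulli m : 1 + m%:R * d <= q ^+ m.
  elim: m => [|m IH]; first by rewrite mul0r addr0 expr0.
  rewrite exprS -natr1; have mR : 0 <= m%:R :> R by [].
  have : q * (1 + m%:R * d) <= q * q ^+ m by rewrite ler_pM2l // (lt_trans _ q1).
  apply: le_trans; have qE : q = 1 + d by rewrite /d addrC subrK.
  have : 0 <= m%:R * d * d by rewrite !mulr_ge0 // ltW.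
  by rewrite {1}qE; lra.
exists (Num.truncn (K / d)).+1.
apply: lt_le_trans (bernoulli _).
have := truncnS_gt (K / d); rewrite ltr_pdivrMr //.
by move/lt_le_trans; apply; rewrite lerDr.
Qed.

(** * The real inner product of a complex Hilbert space *)

Section RealInnerProduct.
Context {R : realType} {H : hilbertSpace R}.
Implicit Types (x y z : H) (c : R) (a : R[i]).

(** The norm of [H] takes its values in [R[i]]; this is the same number in [R]. *)
Definition vnorm x : R := complex.Re `|x|.

Definition rdot x y : R := complex.Re (inner H x y).

Definition rscale c x : H := (Complex c 0) *: x.

Lemma vnormE x : `|x| = Complex (vnorm x) 0.
Proof.
have : 0 <= `|x| by [].
by rewrite /vnorm; case: `|x| => r i; rewrite lecE /= => /andP[/eqP-> _].
Qed.

Lemma vnorm_ge0 x : 0 <= vnorm x.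
Proof. by have : 0 <= `|x| by []; rewrite vnormE lecR. Qed.

Lemma vnorm0 : vnorm (0 : H) = 0.
Proof. by rewrite /vnorm normr0. Qed.

Lemma vnorm_eq0 x : vnorm x = 0 -> x = 0.
Proof. by move=> h; apply/eqP; rewrite -normr_eq0 vnormE h. Qed.

Lemma rdotxx x : rdot x x = vnorm x ^+ 2.
Proof. by rewrite /rdot -hilbert_normE vnormE expr2 /= mulr0 subr0 expr2. Qed.

Lemma inner_conj x y : inner H x y = (inner H y x)^*%C.
Proof. by rewrite hermC expr0 mul1r; exact: erefl. Qed.

Lemma rdotC x y : rdot x y = rdot y x.
Proof. by rewrite /rdot inner_conj; case: (inner H y x). Qed.

Lemma ReD (a b : R[i]) : complex.Re (a + b) = complex.Re a + complex.Re b.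
Proof. by case: a; case: b. Qed.

Lemma rdotDl x y z : rdot (x + y) z = rdot x z + rdot y z.
Proof. by rewrite /rdot linearDl ReD. Qed.

Lemma rdotDr x y z : rdot z (x + y) = rdot z x + rdot z y.
Proof. by rewrite !(rdotC z) rdotDl. Qed.

Lemma rdotNl x z : rdot (- x) z = - rdot x z.
Proof. by rewrite /rdot linearNl /=; case: (inner H x z). Qed.

Lemma rdotNr x z : rdot z (- x) = - rdot z x.
Proof. by rewrite !(rdotC z) rdotNl. Qed.

Lemma rdotBl x y z : rdot (x - y) z = rdot x z - rdot y z.
Proof. by rewrite rdotDl rdotNl. Qed.

Lemma rdotBr x y z : rdot z (x - y) = rdot z x - rdot z y.
Proof. by rewrite rdotDr rdotNr. Qed.

Lemma rdotZ_conj a x y : rdot (a *: x) y = rdot x (conjc a *: y).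
Proof.
rewrite /rdot linearZl_LR linearZr_LR /=.
by congr (complex.Re (_ * _)); rewrite -[RHS]/(conjc (conjc a)) conjcK.
Qed.

Lemma rdotZl c x y : rdot (rscale c x) y = c * rdot x y.
Proof.
rewrite /rdot /rscale linearZl_LR /=.
by case: (inner H x y) => r i /=; rewrite mul0r subr0.
Qed.

Lemma rdotZr c x y : rdot x (rscale c y) = c * rdot x y.
Proof. by rewrite !(rdotC x) rdotZl. Qed.

Lemma rdot0l x : rdot 0 x = 0.
Proof. by have := rdotDl 0 0 x; rewrite addr0; lra. Qed.

Lemma rdot0r x : rdot x 0 = 0.
Proof. by rewrite rdotC rdot0l. Qed.

Lemma Im_inner x y : complex.Im (inner H x y) = rdot x (Complex 0 1 *: y).
Proof.
rewrite /rdot linearZr_LR /=; case: (inner H x y) => r i /=.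
by rewrite mul0r sub0r mulN1r opprK.
Qed.

(** The imaginary part of the inner product is its real part after the second
vector is multiplied by [i], so the real parts determine everything. *)
Lemma inner_eq x y u v : (forall a, rdot x (a *: y) = rdot u (a *: v)) ->
  inner H x y = inner H u v.
Proof.
move=> e; have := e 'i%C; rewrite -!Im_inner.
have := e 1; rewrite !scale1r /rdot.
by case: (inner H x y) => ? ?; case: (inner H u v) => ? ? /= -> ->.
Qed.

Lemma rdot_inj x y : (forall z, rdot z x = rdot z y) -> x = y.
Proof.
move=> e; apply/eqP; rewrite -subr_eq0; apply/eqP/vnorm_eq0.
by apply/eqP; rewrite -sqrf_eq0 -rdotxx rdotBr e subrr.
Qed.

End RealInnerProduct.

Section SemiInner.
Context {R : realType} {H : hilbertSpace R}.
Context (B : H -> H -> R).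
Context (Badd : forall x y z, B (x + y) z = B x z + B y z).
Context (Bscale : forall c x z, B (rscale c x) z = c * B x z).
Context (BC : forall x y, B x y = B y x).
Context (Bpos : forall x, 0 <= B x x).

(** Stated for a semidefinite form because it serves twice: for the inner product
and for the form of a positive operator. *)
Lemma semi_inner_CauchySchwarz x y : B x y ^+ 2 <= B x x * B y y.
Proof.
rewrite mulrC; apply: sqr_le_of_quadratic_ge0 => // t.
suff -> : B y y * t ^+ 2 + 2 * B x y * t + B x x
   = B (rscale t y + x) (rscale t y + x) by [].
rewrite Badd Bscale !(BC _ (_ + _)) !Badd !Bscale (BC x y); ring.
Qed.

End SemiInner.

Section Hilbert.
Context {R : realType} {H : hilbertSpace R}.
Implicit Types (x y z : H) (c : R) (a : R[i]).

Lemma rdot_CauchySchwarz x y : `|rdot x y| <= vnorm x * vnorm y.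
Proof.
rewrite -(@ler_pXn2r _ 2) ?nnegrE ?mulr_ge0 ?vnorm_ge0 //.
rewrite real_normK ?num_real // exprMn -!rdotxx.
apply: semi_inner_CauchySchwarz.
- exact: rdotDl.
- exact: rdotZl.
- exact: rdotC.
- by move=> z; rewrite rdotxx sqr_ge0.
Qed.

Lemma rdot_le x y : rdot x y <= vnorm x * vnorm y.
Proof. exact: le_trans (ler_norm _) (rdot_CauchySchwarz _ _). Qed.

Lemma vnormZ a x : vnorm (a *: x) = complex.Re `|a| * vnorm x.
Proof.
by rewrite /vnorm normrZ (vnormE x) normc_def /= mulr0 subr0.
Qed.

Lemma vnorm_rscale c x : vnorm (rscale c x) = `|c| * vnorm x.
Proof. by rewrite vnormZ normc_def /= expr0n /= addr0 sqrtr_sqr. Qed.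

Lemma vnormD x y : vnorm (x + y) <= vnorm x + vnorm y.
Proof. by have := ler_normD x y; rewrite !vnormE lecE => /andP[]. Qed.

Lemma vnormN x : vnorm (- x) = vnorm x.
Proof. by rewrite /vnorm normrN. Qed.

Lemma vnormB_sym x y : vnorm (x - y) = vnorm (y - x).
Proof. by rewrite -vnormN opprB. Qed.

Lemma bounded_operator_vnorm (T : H -> H) : bounded_operator T <->
  linear T /\ exists2 M : R, 0 < M & forall x, vnorm (T x) <= M * vnorm x.
Proof.
split=> -[lT].
  case=> M hM; split => //; exists (`|complex.Re M| + 1).
    by rewrite ltr_wpDl.
  move=> x; have := hM x; rewrite !vnormE lecE => /andP[_].
  case: M {hM} => m i /=; rewrite mulr0 subr0 => /le_trans; apply.
  apply: ler_wpM2r; first exact: vnorm_ge0.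
  by rewrite (le_trans (ler_norm _)) // lerDl.
case=> M M0 hM; split => //; exists (Complex M 0) => x.
rewrite !vnormE lecE /= !mul0r !mulr0 subr0 addr0 eqxx; exact: hM.
Qed.

Lemma closure_vnorm (M : set H) x : closure M x <->
  forall e : R, 0 < e -> exists2 y, M y & vnorm (x - y) < e.
Proof.
split=> [cl e e0|h].
  have e0' : 0 < Complex e 0 by rewrite ltcR.
  have /cl[y [My]] := nbhsx_ballx x _ e0'.
  by rewrite -ball_normE /= vnormE ltcR => ?; exists y.
move=> B /nbhs_ballP[e /= e0 hB].
have eE : e = Complex (complex.Re e) 0.
  by move: e0; case: (e) => r i; rewrite ltcE /= => /andP[/eqP->].
have [|y My xy] := h (complex.Re e); first by move: e0; rewrite eE ltcR.
exists y; split=> //; apply: hB; rewrite -ball_normE /=.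
by rewrite eE vnormE ltcR.
Qed.

(** Completeness with a rate: the limit inherits the Cauchy bound of the sequence,
and later arguments only handle inequalities between real numbers. *)
Lemma vnorm_complete (u : nat -> H) (b : nat -> R) :
  (forall n m, (n <= m)%N -> vnorm (u m - u n) <= b n) ->
  (forall e, 0 < e -> exists n, b n < e) ->
  exists l, forall n, vnorm (l - u n) <= b n.
Proof.
move=> ub b0.
have : cvg (u @ \oo).
  apply: cauchy_cvg; apply: cauchy_exP => e e0.
  have eE : e = Complex (complex.Re e) 0.
    by move: e0; case: (e) => r i; rewrite ltcE /= => /andP[/eqP->].
  have [|n bn] := b0 (complex.Re e); first by move: e0; rewrite eE ltcR.
  exists (u n); exists n => // m nm /=.
  rewrite -ball_normE /= eE vnormE ltcR vnormB_sym.
  exact: le_lt_trans (ub _ _ nm) bn.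
rewrite cvg_ex => -[l /= Hl]; exists l => n.
apply/ler_addgt0Pr => e e0.
have e0' : 0 < Complex e 0 by rewrite ltcR.
have /cvgrPdist_lt/(_ _ e0')[N _ hN] := Hl.
have := hN (maxn N n) (leq_maxl _ _); rewrite /= vnormE ltcR => le.
rewrite -(subrKA (u (maxn N n))) (le_trans (vnormD _ _)) // addrC.
by apply: lerD; [exact: ub (leq_maxr _ _)|exact: ltW].
Qed.

End Hilbert.

(** * Riesz representation and uniform boundedness *)

Section Riesz.
Context {R : realType} {H : hilbertSpace R}.
Implicit Types (x y z : H) (c : R) (a : R[i]).

Lemma vnormD_sqr x y :
  vnorm (x + y) ^+ 2 = vnorm x ^+ 2 + 2 * rdot x y + vnorm y ^+ 2.
Proof. by rewrite -!rdotxx rdotDl !rdotDr (rdotC y x); ring. Qed.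

Lemma vnormB_sqr x y :
  vnorm (x - y) ^+ 2 = vnorm x ^+ 2 - 2 * rdot x y + vnorm y ^+ 2.
Proof. by rewrite vnormD_sqr rdotNr vnormN; ring. Qed.

(** The vector [s] is the limit of a minimising sequence in [M] of
[J x = |x| ^ 2 - 2 f x]. The parallelogram identity makes the sequence Cauchy,
and at a near-minimum [u n] the inequality [m <= J (u n + t z)] for all [t] is a
quadratic inequality which makes [<u n, z> - f z] small. *)
Lemma riesz_on_subspace (M : set H) (f : H -> R) (C : R) :
  M 0 -> (forall x y, M x -> M y -> M (x + y)) ->
  (forall c x, M x -> M (rscale c x)) ->
  (forall x y, f (x + y) = f x + f y) ->
  (forall c x, f (rscale c x) = c * f x) ->
  (forall x, f x <= C * vnorm x) ->
  exists2 s, closure M s & forall z, M z -> f z = rdot z s.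
Proof.
move=> M0 MD MZ fD fZ fC.
pose J x := vnorm x ^+ 2 - 2 * f x.
pose m := inf [set J x | x in M].
have Jlb : has_inf [set J x | x in M].
  split; first by exists (J 0), 0.
  exists (- C ^+ 2) => _ [x Mx <-]; rewrite /J.
  have := fC x; have := sqr_ge0 (vnorm x - C); rewrite sqrrB => *.
  by nra.
have mJ x : M x -> m <= J x.
  by move=> Mx; apply: ge_inf; [exact: Jlb.2|exists x].
pose b n : R := n.+1%:R^-1.
have b_gt0 n : 0 < b n by rewrite invr_gt0.
have b_ge0 n : 0 <= b n := ltW (b_gt0 n).
have b_le n p : (n <= p)%N -> b p <= b n.
  by move=> np; rewrite lef_pV2 ?posrE // ler_nat.
have b0 e : 0 < e -> exists n, b n < e.
  move=> e0; exists (Num.truncn e^-1).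
  by rewrite -ltf_pV2 ?posrE ?b_gt0 // invrK truncnS_gt.
have /choice[u uP] : forall n, exists x, M x /\ J x < m + b n ^+ 2 / 4.
  move=> n.
  have e0 : 0 < b n ^+ 2 / 4 by rewrite divr_gt0 ?exprn_gt0.
  by have [_ [x Mx <-] lt] := inf_adherent e0 Jlb; exists x.
have cau n p : (n <= p)%N -> vnorm (u p - u n) <= b n.
  move=> np; rewrite -(@ler_pXn2r _ 2) ?nnegrE ?vnorm_ge0 ?b_ge0 //.
  have [[Mn Jn] [Mp Jp]] := (uP n, uP p).
  (* parallelogram identity: [J] at the midpoint is at least [m] *)
  have := mJ _ (MZ 2^-1 _ (MD _ _ Mp Mn)).
  rewrite /J vnorm_rscale exprMn vnormD_sqr fZ fD ger0_norm // => mid.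
  move: Jn Jp; rewrite /J vnormB_sqr => Jn Jp.
  have bb : b p ^+ 2 <= b n ^+ 2 by rewrite ler_pXn2r ?b_le ?nnegrE // ltW ?b_gt0.
  by lra.
have [s sP] := vnorm_complete cau b0.
exists s.
  apply/closure_vnorm => e /b0[n bn]; exists (u n); first exact: (uP n).1.
  exact: le_lt_trans (sP n) bn.
move=> z Mz; apply/eqP; rewrite -subr_eq0 -normr_eq0 eq_le normr_ge0 andbT.
have key n : `|f z - rdot z s| <= 2 * b n * vnorm z.
  have [Mn Jn] := uP n.
  (* discriminant of [J (u n + t z) - J (u n) + b n ^ 2 / 4 >= 0] in [t] *)
  have g : `|rdot (u n) z - f z| <= vnorm z * (b n / 2).
    rewrite -(@ler_pXn2r _ 2) ?nnegrE ?mulr_ge0 ?vnorm_ge0 ?divr_ge0 ?b_ge0 //.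
    rewrite real_normK ?num_real // !exprMn.
    apply: sqr_le_of_quadratic_ge0 => [|t]; first exact: sqr_ge0.
    have := mJ _ (MD _ _ Mn (MZ t _ Mz)).
    rewrite /J vnormD_sqr vnorm_rscale exprMn real_normK ?num_real //.
    rewrite rdotZr fD fZ => h.
    by move: Jn h; rewrite /J; lra.
  have h : `|rdot (s - u n) z| <= b n * vnorm z.
    by rewrite (le_trans (rdot_CauchySchwarz _ _)) // ler_wpM2r ?vnorm_ge0.
  have -> : f z - rdot z s = - (rdot (u n) z - f z) - rdot (s - u n) z.
    by rewrite rdotBl (rdotC z); ring.
  rewrite (le_trans (ler_normB _ _)) // normrN.
  have := vnorm_ge0 z; have := b_gt0 n; nra.
apply/ler_addgt0Pr => e e0; rewrite add0r.
have k0 : 0 < 2 * vnorm z + 1 by have := vnorm_ge0 z; lra.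
have [n bn] := b0 (e / (2 * vnorm z + 1)) (divr_gt0 e0 k0).
apply: le_trans (key n) _; move: bn; rewrite ltr_pdivlMr // => bn.
by have := b_gt0 n; have := vnorm_ge0 z; nra.
Qed.

(** The uniform boundedness principle for the functionals [<_, u>], by a gliding
hump in the manner of Sokal. If [U] is unbounded, take [u n] in [U] of norm more
than [2 (n + 1) 3 ^ n] and move the current point by [3 ^ - n] along [u n], in the
direction that increases [|<x, u n>|]. All later moves together have length at
most half of this one, so the limit [l] has [|<l, u n>| > n + 1] for all [n]. *)
Lemma weakly_bounded_bounded (U : set H) :
  (forall x, exists K, forall u, U u -> `|rdot x u| <= K) ->
  exists2 C, 0 < C & forall u, U u -> vnorm u <= C.
Proof.
move=> wb; apply: contrapT => unb.
have big C : exists u, U u /\ C < vnorm u.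
  apply: contrapT => no; apply: unb; exists (`|C| + 1).
    by rewrite ltr_wpDl.
  move=> u Uu; rewrite leNgt; apply/negP => lt; apply: no; exists u; split => //.
  by rewrite (le_lt_trans _ lt) // (le_trans (ler_norm _)) // lerDl.
pose d n : R := 3^-1 ^+ n.
have d_gt0 n : 0 < d n by rewrite exprn_gt0 // invr_gt0.
have dS n : d n.+1 = d n / 3 by rewrite /d exprSr.
have d0 e : 0 < e -> exists n, 3 / 2 * d n < e.
  move=> e0; exists (Num.truncn (3 / 2 / e)).
  set n := Num.truncn _.
  have lt1 : 3 / 2 / e < n.+1%:R := truncnS_gt _.
  have lt2 : n.+1%:R <= 3 ^+ n :> R by rewrite -natrX ler_nat ltn_expl.
  rewrite /d exprVn ltr_pdivrMr ?exprn_gt0 // -ltr_pdivrMl // mulrC.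
  exact: lt_le_trans lt1 lt2.
have /choice[u uP] : forall n, exists u, U u /\ 2 * n.+1%:R / d n < vnorm u.
  by move=> n; exact: big.
have u_gt0 n : 0 < vnorm (u n).
  by apply: lt_trans (uP n).2; rewrite divr_gt0 ?mulr_gt0.
pose sg (r : R) : R := if 0 <= r then 1 else - 1.
have sg1 r : `|sg r| = 1 by rewrite /sg; case: ifP; rewrite ?normrN normr1.
pose step n x := x + rscale (sg (rdot x (u n)) * (d n / vnorm (u n))) (u n).
pose fix xs n := if n is p.+1 then step p (xs p) else 0.
have xsS n : vnorm (xs n.+1 - xs n) = d n.
  rewrite /= /step addrAC subrr add0r vnorm_rscale normrM sg1 mul1r.
  by rewrite gtr0_norm ?divr_gt0 // divfK ?gt_eqF.
have xs_le n p : vnorm (xs (n + p)%N - xs n) <= 3 / 2 * (d n - d (n + p)%N).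
  elim: p => [|p IH]; first by rewrite addn0 !subrr mulr0 vnorm0.
  rewrite -(subrKA (xs (n + p)%N)) (le_trans (vnormD _ _)) // addnS xsS dS.
  by move: IH; lra.
have [l lP] : exists l, forall n, vnorm (l - xs n) <= 3 / 2 * d n.
  apply: vnorm_complete d0 => n p np; rewrite -(subnKC np).
  by apply: le_trans (xs_le _ _) _; have := d_gt0 (n + (p - n))%N; lra.
have hump n : d n * vnorm (u n) <= `|rdot (xs n.+1) (u n)|.
  have -> : rdot (xs n.+1) (u n) =
      rdot (xs n) (u n) + sg (rdot (xs n) (u n)) * (d n * vnorm (u n)).
    by rewrite /= /step rdotDl rdotZl rdotxx; field; rewrite gt_eqF ?u_gt0.
  rewrite /sg; case: ifP => [a0|/negbT]; last rewrite -ltNge -normrN => a0.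
    by apply: le_trans (ler_norm _); lra.
  by apply: le_trans (ler_norm _); lra.
(* half of the hump at [u n] survives in the limit, and exceeds [n + 1 > K] *)
have [K hK] := wb l.
pose n := Num.truncn K.
have := hK _ (uP n).1; apply/negP; rewrite -ltNge.
apply: lt_le_trans (truncnS_gt K) _; rewrite -/n.
have t : `|rdot (l - xs n.+1) (u n)| <= d n / 2 * vnorm (u n).
  apply: le_trans (rdot_CauchySchwarz _ _) _.
  apply: ler_wpM2r; first exact: vnorm_ge0.
  by have := lP n.+1; rewrite dS; lra.
have t2 := lerB_normD (rdot (xs n.+1) (u n)) (rdot (l - xs n.+1) (u n)).
move: t2; rewrite -rdotDl (addrC (xs n.+1)) subrK => t2.
have := (uP n).2; rewrite ltr_pdivrMr // => t3.
by have := hump n; lra.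
Qed.

End Riesz.

(** * Adjoints *)

Section Adjoint.
Context {R : realType} {H : hilbertSpace R}.
Implicit Types (x y z : H) (c : R) (a : R[i]) (T : H -> H).

Lemma linear_add T : linear T -> {morph T : x y / x + y}.
Proof. by move=> lT x y; have := lT 1 x y; rewrite !scale1r. Qed.

Lemma linear_zero T : linear T -> T 0 = 0.
Proof. by move=> lT; have := lT (- 1) 0 0; rewrite !scaleN1r !addNr. Qed.

Lemma linear_scale T : linear T -> forall a x, T (a *: x) = a *: T x.
Proof. by move=> lT a x; have := lT a x 0; rewrite (linear_zero lT) !addr0. Qed.

Lemma linear_rscale T : linear T -> forall c x, T (rscale c x) = rscale c (T x).
Proof. by move=> lT c x; exact: linear_scale. Qed.

Lemma linear_sub T : linear T -> {morph T : x y / x - y}.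
Proof. by move=> lT x y; have := lT (- 1) y x; rewrite !scaleN1r !(addrC (- _)). Qed.

Lemma rdotZ_conjr a x y : rdot x (a *: y) = rdot (conjc a *: x) y.
Proof. by rewrite [RHS]rdotZ_conj conjcK. Qed.

(** For fixed [y] the vector [adjoint T y] represents the real part of
[x |-> <T x, y>]. Moving a complex scalar across the real form conjugates it
([rdotZ_conj]); this gives complex linearity of the adjoint, and then the equality
of the real parts extends to the complex inner products. *)
Lemma adjointP T : bounded_operator T -> bounded_operator (adjoint T) /\
  forall x y, inner H (T x) y = inner H x (adjoint T y).
Proof.
move=> /bounded_operator_vnorm[lT [K K0 hK]].
suff : exists S, bounded_operator S /\ forall x y, inner H (T x) y = inner H x (S y).
  exact: xgetPex.
have /choice[S SP] : forall y, exists s, forall z, rdot (T z) y = rdot z s.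
  move=> y.
  have [||||||s _ sP] := @riesz_on_subspace _ H setT
    (fun x => rdot (T x) y) (K * vnorm y) => //.
  - by move=> u v; rewrite (linear_add lT) rdotDl.
  - by move=> c x; rewrite (linear_scale lT) rdotZl.
  - move=> x; rewrite (le_trans (rdot_le _ _)) // mulrAC.
    by rewrite ler_wpM2r ?vnorm_ge0.
  - by exists s => z; exact: sP.
have lS : linear S.
  move=> a u v; apply: rdot_inj => z.
  by rewrite rdotDr rdotZ_conjr -!SP rdotDr (linear_scale lT) rdotZ_conjr.
exists S; split; last first.
  by move=> x y; apply: inner_eq => a; rewrite SP (linear_scale lS).
apply/bounded_operator_vnorm; split => //; exists K => // y.
have := rdot_le (T (S y)) y; rewrite SP rdotxx => le1.
have := hK (S y); have := vnorm_ge0 y; have := vnorm_ge0 (S y).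
rewrite le_eqVlt => /predU1P[<-|Sp] y0 le2; first by rewrite mulr_ge0 // ltW.
rewrite -(ler_pM2l Sp) -expr2 (le_trans le1) //.
by rewrite mulrCA mulrA ler_wpM2r.
Qed.

End Adjoint.

(** * The semi-inner product of a positive operator and the sharp *)

Section SemiHilbert.
Context {R : realType} {H : hilbertSpace R}.
Context (A : H -> H) (hA : positive_operator A).
Implicit Types (x y z : H) (c : R) (a : R[i]) (T S F G : H -> H).

Local Notation p := (normA A).

Let lA : linear A.
Proof. by case: hA => -[]. Qed.

(** Over the complex numbers positivity implies symmetry: [<A z, z>] is real, i.e.
[Re <A z, i z> = 0]; polarising and taking the pair [x], [i y] gives the claim. *)
Lemma positive_operator_sym x y : rdot (A x) y = rdot x (A y).
Proof.
have imA z : rdot (A z) (Complex 0 1 *: z) = 0.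
  by rewrite -Im_inner; exact: ger0_Im (hA.2 z).
have polar u v :
    rdot (A u) (Complex 0 1 *: v) + rdot (A v) (Complex 0 1 *: u) = 0.
  have := imA (u + v); rewrite scalerDr (linear_add lA) !rdotDl !rdotDr !imA.
  by rewrite add0r addr0.
have ii : Complex 0 1 *: (Complex 0 1 *: y) = - y.
  rewrite scalerA -scaleN1r; congr (_ *: _).
  by apply/eqP; rewrite eq_complex; apply/andP; split; apply/eqP => /=; ring.
have := polar x (Complex 0 1 *: y).
rewrite ii (linear_scale lA) rdotNr rdotZ_conj scalerA.
rewrite (_ : conjc _ * _ = 1) ?scale1r; last first.
  by apply/eqP; rewrite eq_complex; apply/andP; split; apply/eqP => /=; ring.
by rewrite (rdotC x); lra.
Qed.

Lemma rdotA_ge0 x : 0 <= rdot (A x) x.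
Proof. by have := hA.2 x; rewrite lecE => /andP[]. Qed.

Lemma normA_sqr x : p x ^+ 2 = rdot (A x) x.
Proof. by rewrite sqr_sqrtr // rdotA_ge0. Qed.

Lemma normA_ge0 x : 0 <= p x.
Proof. exact: sqrtr_ge0. Qed.

Lemma normA_CauchySchwarz x y : `|rdot (A x) y| <= p x * p y.
Proof.
rewrite -(@ler_pXn2r _ 2) ?nnegrE ?mulr_ge0 ?normA_ge0 //.
rewrite real_normK ?num_real // exprMn !normA_sqr.
apply: (@semi_inner_CauchySchwarz _ _ (fun x y => rdot (A x) y)).
- by move=> u v w; rewrite (linear_add lA) rdotDl.
- by move=> c u v; rewrite (linear_scale lA) rdotZl.
- by move=> u v; rewrite positive_operator_sym rdotC.
- exact: rdotA_ge0.
Qed.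

Lemma rdotA_le x y : rdot (A x) y <= p x * p y.
Proof. exact: le_trans (ler_norm _) (normA_CauchySchwarz _ _). Qed.

Lemma normAD x y : p (x + y) <= p x + p y.
Proof.
rewrite -(@ler_pXn2r _ 2) ?nnegrE ?addr_ge0 ?normA_ge0 //.
rewrite sqrrD !normA_sqr (linear_add lA) !rdotDl !rdotDr.
rewrite (positive_operator_sym y) (rdotC y).
by have := rdotA_le x y; lra.
Qed.

(** For [x] the value [S x] is the projection on [closure (range A)] of a
preimage under [A] of [T^* (A x)]; [A (S x)] is not changed by the projection
because [A] vanishes on the orthogonal complement of its range. The same
orthogonality makes [S x] unique, hence [S] linear. *)
Lemma sharpP T : bounded_A A T ->
  bounded_operator (sharp A T) /\
  forall u v, rdot (A (sharp A T u)) v = rdot (A u) (T v).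
Proof.
move=> [bT ranT].
have [bTs adjT] := adjointP bT.
have [lTs _] := bTs.
have Tadj x y : rdot (T x) y = rdot x (adjoint T y) by rewrite /rdot adjT.
suff [S [bS eS cS]] : exists S, [/\ bounded_operator S,
    A \o S = adjoint T \o A & range S `<=` closure (range A)].
  have [b e _] := xgetPex 0 (ex_intro (fun S => [/\ bounded_operator S,
    A \o S = adjoint T \o A & range S `<=` closure (range A)]) S
    (And3 bS eS cS)).
  split=> // u v.
  have -> : A (sharp A T u) = adjoint T (A u) by exact: (congr1 (@^~ u) e).
  by rewrite rdotC -Tadj rdotC.
have /choice[S SP] : forall x, exists y,
    A y = adjoint T (A x) /\ closure (range A) y.
  move=> x; have [y0 _ ey0] := ranT _ (ex_intro2 _ _ x I erefl).
  have [||||||y cy yP] := @riesz_on_subspace _ H (range A) (rdot y0) (vnorm y0).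
  - by exists 0; rewrite ?(linear_zero lA).
  - by move=> _ _ [u _ <-] [v _ <-]; exists (u + v); rewrite ?(linear_add lA).
  - by move=> c _ [u _ <-]; exists (rscale c u); rewrite ?(linear_scale lA).
  - by move=> u v; rewrite rdotDr.
  - by move=> c u; rewrite rdotZr.
  - exact: rdot_le.
  exists y; split=> //; rewrite -[RHS]/((adjoint T \o A) x) -ey0.
  apply: rdot_inj => z; rewrite -!positive_operator_sym -yP; last by exists z.
  exact: rdotC.
have eS x : A (S x) = adjoint T (A x) := (SP x).1.
have approx x e : 0 < e -> exists w, vnorm (S x - A w) < e.
  by move=> e0; have /closure_vnorm/(_ e e0)[_ [w _ <-]] := (SP x).2; exists w.
have orth k x : A k = 0 -> rdot k (S x) = 0.
  move=> Ak; apply/eqP; rewrite -normr_eq0 eq_le normr_ge0 andbT.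
  apply/ler_addgt0Pr => e e0; rewrite add0r.
  have k0 : 0 < vnorm k + 1 by have := vnorm_ge0 k; lra.
  have [w] := approx x _ (divr_gt0 e0 k0); rewrite ltr_pdivlMr // => hw.
  have -> : rdot k (S x) = rdot k (S x - A w).
    by rewrite rdotBr -positive_operator_sym Ak rdot0l subr0.
  apply: le_trans (rdot_CauchySchwarz _ _) _.
  by have := vnorm_ge0 (S x - A w); have := vnorm_ge0 k; nra.
have lS : linear S.
  move=> a u v; apply/eqP; rewrite -subr_eq0; apply/eqP/vnorm_eq0.
  set d := S (a *: u + v) - _.
  have Ad : A d = 0.
    rewrite !(linear_sub lA) !(linear_add lA) !(linear_scale lA) !eS.
    rewrite (linear_add lA) (linear_scale lA).
    by rewrite (linear_add lTs) (linear_scale lTs) subrr.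
  apply/eqP; rewrite -sqrf_eq0 -rdotxx {2}/d rdotBr rdotDr rdotZ_conjr.
  by rewrite !orth ?(linear_scale lA) ?Ad ?scaler0 // addr0 subrr.
have Srdot x w : rdot (S x) (A w) = rdot x (A (T w)).
  by rewrite -positive_operator_sym eS rdotC -Tadj rdotC positive_operator_sym.
(* at [x] the functionals [<_, A (T w)>] are bounded by [|S x|] *)
have [|C C0 CP] := @weakly_bounded_bounded _ H
    [set u | exists2 w, vnorm (A w) <= 1 & u = A (T w)].
  move=> x; exists (vnorm (S x)) => _ [w w1 ->].
  rewrite -Srdot (le_trans (rdot_CauchySchwarz _ _)) //.
  by rewrite ler_piMr ?vnorm_ge0.
have Sbnd x w : rdot (S x) (A w) <= C * vnorm x * vnorm (A w).
  have := vnorm_ge0 (A w); rewrite le_eqVlt => /predU1P[e0|Aw].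
    by rewrite -e0 (vnorm_eq0 (esym e0)) rdot0r mulr0.
  have := CP (A (T (rscale (vnorm (A w))^-1 w))).
  rewrite (linear_rscale bT.1) (linear_rscale lA) !vnorm_rscale.
  rewrite gtr0_norm ?invr_gt0 // => h.
  have {h} : (vnorm (A w))^-1 * vnorm (A (T w)) <= C.
    apply: h; exists (rscale (vnorm (A w))^-1 w).
      by rewrite (linear_rscale lA) vnorm_rscale gtr0_norm ?invr_gt0 // mulVf ?gt_eqF.
    by rewrite (linear_rscale bT.1) (linear_rscale lA).
  rewrite mulrC ler_pdivrMr // => h.
  rewrite Srdot (le_trans (rdot_le _ _)) // mulrAC mulrC.
  by rewrite ler_wpM2r ?vnorm_ge0.
exists S; split.
- apply/bounded_operator_vnorm; split=> //; exists C => // x.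
  have Sx0 := vnorm_ge0 (S x); have x0 := vnorm_ge0 x.
  (* replace [S x] by a nearby [A w] in the second place of [<S x, S x>] *)
  have key : vnorm (S x) ^+ 2 <= C * vnorm x * vnorm (S x).
    apply/ler_addgt0Pr => e e0.
    have k0 : 0 < vnorm (S x) + C * vnorm x + 1.
      by rewrite ltr_wpDl // addr_ge0 // mulr_ge0 // ltW.
    have [w] := approx x _ (divr_gt0 e0 k0); rewrite ltr_pdivlMr // => hw.
    have h1 := rdot_le (S x) (S x - A w).
    have h2 := Sbnd x w.
    have h3 : vnorm (A w) <= vnorm (S x) + vnorm (S x - A w).
      by have := vnormD (S x) (A w - S x); rewrite addrC subrK vnormB_sym.
    have Cx : 0 <= C * vnorm x by rewrite mulr_ge0 // ltW.
    have h4 := ler_wpM2l Cx h3.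
    have h5 := vnorm_ge0 (S x - A w).
    by move: h1; rewrite -rdotxx rdotBr; lra.
  move: Sx0; rewrite le_eqVlt => /predU1P[<-|Sp]; first by rewrite mulr_ge0 // ltW.
  by rewrite -(ler_pM2r Sp) -expr2.
- by apply/funext => x; exact: eS.
- by move=> _ [x _ <-]; exact: (SP x).2.
Qed.

(** * Boundedness for the seminorm of a positive operator *)

Definition normA_bounded F := exists2 c, 0 < c & forall x, p (F x) <= c * p x.

Lemma normA_le_vnorm : exists2 k, 0 < k & forall x, p x <= k * vnorm x.
Proof.
have [_ [k k0 hk]] := (bounded_operator_vnorm A).1 hA.1.
exists (k + 1) => [|x]; first by rewrite addr_gt0.
rewrite -(@ler_pXn2r _ 2) ?nnegrE ?mulr_ge0 ?normA_ge0 ?vnorm_ge0 //; last first.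
  by rewrite addr_ge0 // ltW.
rewrite normA_sqr // (le_trans (rdot_le _ _)) //.
have := hk x; have := vnorm_ge0 x; rewrite exprMn; set v := vnorm x => v0 le1.
have : vnorm (A x) * v <= k * v * v by rewrite ler_wpM2r.
have := sqr_ge0 v; rewrite !expr2; nra.
Qed.

(** A symmetrisation argument of Krein and Lax. With [c m = p (F ^ m x)], symmetry
and the Cauchy-Schwarz inequality give [c (m + 1) ^ 2 <= c m * c (m + 2)], so the
ratios of [c] increase. If the first ratio [r] exceeded the norm bound [b], then
[c m >= r ^ m * c 0], whereas [c m <= k * |F ^ m x| <= k * b ^ m * |x|]. *)
Lemma symmetric_normA_bounded F : bounded_operator F ->
  (forall u v, rdot (A (F u)) v = rdot (A u) (F v)) -> normA_bounded F.
Proof.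
move=> /bounded_operator_vnorm[lF [b b0 hb]] symF.
exists b => // x; rewrite leNgt; apply/negP => big.
pose c m := p (iter m F x).
have c_ge0 m : 0 <= c m by exact: normA_ge0.
have convex m : c m.+1 ^+ 2 <= c m * c m.+2.
  by rewrite normA_sqr //= symF; exact: rdotA_le.
have c0 : 0 < c 0%N.
  rewrite lt_def c_ge0 andbT; apply/eqP => e0.
  have := convex 0%N; rewrite e0 mul0r => h; have c10 : c 1%N = 0.
    by apply/eqP; rewrite -sqrf_eq0 eq_le h sqr_ge0.
  by move: big; rewrite -[p (F x)]/(c 1%N) -[p x]/(c 0%N) c10 e0 mulr0 ltxx.
pose r := c 1%N / c 0%N.
have rb : b < r by rewrite ltr_pdivlMr.
have r0 : 0 < r := lt_trans b0 rb.
have grow m : 0 < c m /\ r * c m <= c m.+1.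
  elim: m => [|m [cm IH]]; first by rewrite /r divfK ?gt_eqF.
  have cS : 0 < c m.+1 by apply: lt_le_trans IH; rewrite mulr_gt0.
  split => //; rewrite -(ler_pM2l cm); apply: le_trans (convex m).
  by rewrite mulrA (mulrC _ r) expr2 ler_pM2r.
have lower m : r ^+ m * c 0%N <= c m.
  elim: m => [|m IH]; first by rewrite expr0 mul1r.
  by rewrite exprS -mulrA (le_trans _ (grow m).2) // ler_pM2l.
have upper m : vnorm (iter m F x) <= b ^+ m * vnorm x.
  elim: m => [|m IH]; first by rewrite expr0 mul1r.
  by rewrite exprS -mulrA (le_trans (hb _)) // ler_pM2l.
have [k k0 hk] := normA_le_vnorm.
have [|m] := @expr_unbounded _ (r / b) (k * vnorm x / c 0%N).
  by rewrite ltr_pdivlMr // mul1r.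
apply/negP; rewrite -leNgt ler_pdivlMr // expr_div_n mulrAC.
rewrite ler_pdivrMr ?exprn_gt0 // (le_trans (lower m)) // (le_trans (hk _)) //.
by rewrite -mulrA ler_pM2l // mulrC.
Qed.

(** [S \o T] is symmetric for the form of [A], and [p (T x) ^ 2 = <A (S (T x)), x>];
the bound for [S] follows from the one for [T] as for ordinary adjoints. *)
Lemma adjoint_pair_normA_bounded T S :
  bounded_operator T -> bounded_operator S ->
  (forall u v, rdot (A (S u)) v = rdot (A u) (T v)) ->
  normA_bounded T /\ normA_bounded S.
Proof.
move=> bT bS ST.
have bST : bounded_operator (S \o T).
  have [lT [t t0 ht]] := (bounded_operator_vnorm T).1 bT.
  have [lS [s s0 hs]] := (bounded_operator_vnorm S).1 bS.
  apply/bounded_operator_vnorm; split.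
    by move=> a u v /=; rewrite lT lS.
  exists (s * t) => [|x /=]; first exact: mulr_gt0.
  by rewrite (le_trans (hs _)) // -mulrA ler_pM2l.
have [|b b0 hb] := symmetric_normA_bounded bST.
  move=> u v /=; rewrite ST [RHS]positive_operator_sym // [RHS]rdotC ST.
  by rewrite positive_operator_sym // rdotC.
have bT' : normA_bounded T.
  (* [p (T x) ^ 2 <= b * p x ^ 2], and [b <= (b + 1) ^ 2] avoids a square root *)
  exists (b + 1) => [|x]; first by rewrite addr_gt0.
  rewrite -(@ler_pXn2r _ 2) ?nnegrE ?mulr_ge0 ?normA_ge0 //; last first.
    by rewrite addr_ge0 // ltW.
  rewrite normA_sqr // -ST (le_trans (rdotA_le _ _)) //.
  have := hb x; rewrite /= exprMn; have := normA_ge0 x; set v := p x => v0 le1.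
  have : p (S (T x)) * v <= b * v * v by rewrite ler_wpM2r.
  have := sqr_ge0 v; rewrite !expr2; nra.
split=> //; have [t t0 ht] := bT'; exists t => // x.
have := normA_ge0 (S x); rewrite le_eqVlt => /predU1P[<-|Sx].
  by rewrite mulr_ge0 ?normA_ge0 // ltW.
rewrite -(ler_pM2r Sx) -expr2 normA_sqr // ST (le_trans (rdotA_le _ _)) //.
by rewrite mulrC mulrAC ler_wpM2r ?normA_ge0.
Qed.

Lemma normA0 : p 0 = 0.
Proof. by apply/eqP; rewrite -sqrf_eq0 normA_sqr // rdot0r. Qed.

Lemma normA_bounded_comp F G :
  normA_bounded F -> normA_bounded G -> normA_bounded (F \o G).
Proof.
move=> [s s0 hs] [t t0 ht]; exists (s * t) => [|x /=]; first exact: mulr_gt0.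
by rewrite (le_trans (hs _)) // -mulrA ler_pM2l.
Qed.

Lemma normA_bounded_sum (I : finType) (P : pred I) (F : I -> H -> H) :
  (forall i, P i -> normA_bounded (F i)) ->
  normA_bounded (\sum_(i | P i) F i).
Proof.
move=> bF; elim/big_ind: _ => //.
  by exists 1 => // x; rewrite normA0 mul1r normA_ge0.
move=> G1 G2 [s s0 hs] [t t0 ht]; exists (s + t) => [|x]; first exact: addr_gt0.
by rewrite (le_trans (normAD _ _)) // mulrDl lerD.
Qed.

Lemma normA_le_opnormA F x : normA_bounded F -> p x = 1 ->
  p (F x) <= opnormA A F.
Proof.
move=> [c c0 hc] x1; apply: ub_le_sup; last by exists x.
by exists c => _ [y /= y1 <-]; rewrite (le_trans (hc _)) // y1 mulr1.
Qed.

Lemma opnormA_ge0 F : 0 <= opnormA A F.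
Proof.
rewrite /opnormA; set V := [set _ | _ in _].
have [[[v Vv] ubV]|nV] := pselect (has_sup V); last by rewrite sup_out.
apply: le_trans (ub_le_sup ubV Vv).
by have [x _ <-] := Vv; exact: normA_ge0.
Qed.

Lemma rdotA_le_opnormA F x : normA_bounded F -> p x = 1 ->
  rdot (A (F x)) x <= opnormA A F.
Proof.
move=> bF x1; apply: le_trans (normA_le_opnormA bF x1).
by rewrite -[leRHS]mulr1 -x1; exact: rdotA_le.
Qed.

(** [0 <= c] is what covers the case [A = 0], where no [x] has [p x = 1]. *)
Lemma opnormA_sqr_le F c : 0 <= c ->
  (forall x, p x = 1 -> p (F x) ^+ 2 <= c) -> opnormA A F ^+ 2 <= c.
Proof.
move=> c0 hF.
have -> : c = Num.sqrt c ^+ 2 by rewrite sqr_sqrtr.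
rewrite ler_pXn2r ?nnegrE ?opnormA_ge0 ?sqrtr_ge0 //.
rewrite /opnormA; set V := [set _ | _ in _].
have [V0|/set0P V0] := eqVneq V set0; first by rewrite V0 sup0 sqrtr_ge0.
apply: ge_sup V0 _ => _ [x /= x1 <-].
by rewrite -(@ler_pXn2r _ 2) ?nnegrE ?normA_ge0 ?sqrtr_ge0 // (sqr_sqrtr c0) hF.
Qed.

End SemiHilbert.

Theorem theorem2p4 (R : realType) (H : hilbertSpace R) (A : H -> H)
    (hA : positive_operator A)
    (n : nat) (hn : (1 <= n)%N) (X : 'I_n -> H -> H)
    (hX : forall k, bounded_A A (X k)) :
  let D := \sum_(k < n) (sharp A (X k) \o X k) in
  opnormA A (\sum_(k < n) X k) ^+ 2 <=
    opnormA A D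
    + 2^-1 * opnormA A (\sum_(k < n) \sum_(j < n | j != k)
                          (sharp A (X j) \o X k)) ^+ 2
    + 2^-1
  /\
  opnormA A D
    + 2^-1 * opnormA A (\sum_(k < n) \sum_(j < n | j != k)
                          (sharp A (X j) \o X k)) ^+ 2
    + 2^-1
  = opnormA A D
    + 2^-1 * opnormA A (((\sum_(j < n) sharp A (X j))
                           \o (\sum_(k < n) X k)) - D) ^+ 2
    + 2^-1.
Proof.
move=> D; set E := \sum_(k < n) \sum_(j < n | j != k) _.
set G := _ \o _.
have lA : linear A := hA.1.1.
have bS k := (sharpP hA (hX k)).1.
have adjS k := (sharpP hA (hX k)).2.
have GE : G - D = E.
  apply/funext => x; rewrite /G /D /E.
  rewrite -[LHS]/((\sum_(j < n) sharp A (X j)) ((\sum_(k < n) X k) x) -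
    (\sum_(k < n) (sharp A (X k) \o X k)) x).
  rewrite !fct_sumE.
  under eq_bigr => j _.
    rewrite (big_morph _ (linear_add (bS j).1) (linear_zero (bS j).1)).
    over.
  rewrite exchange_big -sumrB /=; apply: eq_bigr => k _.
  by rewrite fct_sumE (bigD1 k) //= addrAC subrr add0r.
rewrite GE; split => //.
have bX k := adjoint_pair_normA_bounded hA (hX k).1 (bS k) (adjS k).
have bD : normA_bounded A D.
  apply: normA_bounded_sum => // k _.
  by apply: normA_bounded_comp; [exact: (bX k).2|exact: (bX k).1].
have bE : normA_bounded A E.
  apply: normA_bounded_sum => // k _; apply: normA_bounded_sum => // j _.
  by apply: normA_bounded_comp; [exact: (bX j).2|exact: (bX k).1].
have D0 := opnormA_ge0 A D; have E0 := sqr_ge0 (opnormA A E).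
apply: opnormA_sqr_le => [|x x1]; first lra.
have -> : normA A ((\sum_(k < n) X k) x) ^+ 2 = rdot (A (G x)) x.
  rewrite normA_sqr // /G /= [in RHS]fct_sumE.
  rewrite (big_morph _ (linear_add lA) (linear_zero lA)).
  rewrite (big_morph (rdot^~ x) (fun u v => rdotDl u v x) (rdot0l x)).
  under [RHS]eq_bigr do rewrite adjS.
  rewrite -(big_morph _ (fun u v => rdotDr u v _) (rdot0r _)).
  by congr rdot; rewrite fct_sumE.
have -> : G x = D x + E x by rewrite -GE addrC subrK.
rewrite (linear_add lA) rdotDl.
have := rdotA_le_opnormA hA bD x1; have := rdotA_le_opnormA hA bE x1.
have := sqr_ge0 (opnormA A E - 1); rewrite sqrrB; lra.
Qed.
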